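(* For every positive integer $n$ there exists an open and dense set $\Omega=\Omega_n\subset(\mathbb{R}^2)^n$ all of whose elements are $n$-point configurations that are reconstructible from distances, and there is an algorithm which, given any $(p_1,\ldots,p_n)\in(\mathbb{R}^2)^n$, determines in $O(n^{11})$ steps whether $(p_1,\ldots,p_n)$ lies in $\Omega_n$.
   Context: The distribution of distances of a configuration $p_1,\ldots,p_n\in\mathbb{R}^2$ is the multiset of the pairwise distances $\|p_i-p_j\|$, $1\le i<j\le n$. A rigid motion of $\mathbb{R}^2$ is a pair $(M,T)$ with $M$ an orthogonal $2\times 2$ matrix and $T\in\mathbb{R}^2$, acting by $x\mapsto Mx+T$. A configuration $p_1,\ldots,p_n\in\mathbb{R}^2$ is called reconstructible from distances if, for every $q_1,\ldots,q_n\in\mathbb{R}^2$ having the same distribution of distances, there exist a rigid motion $(M,T)$ and a permutation $\pi$ of $\{1,\ldots,n\}$ such that $Mp_i+T=q_{\pi(i)}$ for every $i=1,\ldots,n$. Steps are counted in exact real arithmetic: a step is an arithmetic operation on real numbers or a comparison of real numbers (equivalently, up to a constant factor, the evaluation of a fixed polynomial at real numbers together with a test whether its value is zero). The input is the list of the coordinates of the points, and the constant in $O(n^{11})$ is independent of the input. *)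

(* Defs.v *)
From HB Require Import structures.
From mathcomp Require Import all_boot all_order all_algebra all_fingroup.
From mathcomp Require Import all_classical all_reals all_analysis.

Set Implicit Arguments.
Unset Strict Implicit.
Unset Printing Implicit Defensive.

Import Order.TTheory GRing.Theory Num.Theory.
Local Open Scope ring_scope.

(* An n-point configuration of the plane is a matrix p : 'M[R]_(2, n); its
   i-th point is the column [col i p].  The topology of (R^2)^n is the
   canonical (entrywise) one on matrices. *)

Section Reconstruction.
Variables (R : realType) (n : nat).
Implicit Types (p q : 'M[R]_(2, n)).

(* The canonical norm on MathComp-Analysis matrices is the sup norm, hence
   the explicit formula for the Euclidean one. *)
Definition edist (x y : 'cV[R]_2) : R :=
  Num.sqrt (\sum_k (x k 0 - y k 0) ^+ 2).

Definition distances p : seq R :=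
  [seq edist (col ij.1 p) (col ij.2 p) | ij : 'I_n * 'I_n in
    [pred ij : 'I_n * 'I_n | (ij.1 < ij.2)%N]].

(* Equality of multisets is [perm_eq] of the listings. *)
Definition same_distribution p q := perm_eq (distances p) (distances q).

Definition orthogonal_mx (M : 'M[R]_2) := M^T *m M = 1%:M.

Definition reconstructible p : Prop :=
  forall q, same_distribution p q ->
    exists (M : 'M[R]_2) (T : 'cV[R]_2) (s : 'S_n),
      orthogonal_mx M /\ forall i, M *m col i p + T = col (s i) q.

(* The points one after the other, each as abscissa then ordinate. *)
Definition coordinates p : seq R :=
  [seq p k i | i <- enum 'I_n, k <- enum 'I_2].

End Reconstruction.

(* Real RAM programs.  A state has natural-number index registers, real
   registers, and a real memory addressed through the index registers.  There
   is no conversion between reals and indices (in particular no floor), index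
   arithmetic is additive, and the only real constants are integers, so that
   unit cost hides no work.  Programs do not depend on R nor on the number of
   points. *)

Inductive real_op := RAdd | RSub | RMul | RDiv.

Inductive instr :=
| IConst (x k : nat)
| IAdd (x y z : nat)
| ISub (x y z : nat)
| RConst (d : nat) (c : int)
| ROp (o : real_op) (d a b : nat)
| RLoad (d x : nat)
| RStore (x a : nat).

Inductive test :=
| IEq (x y : nat) | ILt (x y : nat) | REq (a b : nat) | RLt (a b : nat).

Inductive program :=
| Skip
| Instr (i : instr)
| Seq (c1 c2 : program)
| If (t : test) (c1 c2 : program)
| While (t : test) (c : program).

Section Semantics.
Variable R : realType.

Record state := State {
  idx : nat -> nat;
  reg : nat -> R;
  ram : nat -> R }.

(* Division by zero is a runtime error, unlike in MathComp fields. *)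
Definition eval_op (o : real_op) (a b : R) : option R :=
  match o with
  | RAdd => Some (a + b)
  | RSub => Some (a - b)
  | RMul => Some (a * b)
  | RDiv => if b == 0 then None else Some (a / b)
  end.

Definition set_idx (s : state) x k :=
  State [eta idx s with x |-> k] (reg s) (ram s).
Definition set_reg (s : state) d v :=
  State (idx s) [eta reg s with d |-> v] (ram s).
Definition set_mem (s : state) k v :=
  State (idx s) (reg s) [eta ram s with k |-> v].

Definition eval_instr (i : instr) (s : state) : option state :=
  match i with
  | IConst x k => Some (set_idx s x k)
  | IAdd x y z => Some (set_idx s x (idx s y + idx s z)%N)
  | ISub x y z => Some (set_idx s x (idx s y - idx s z)%N)
  | RConst d c => Some (set_reg s d c%:~R)
  | ROp o d a b => omap (set_reg s d) (eval_op o (reg s a) (reg s b))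
  | RLoad d x => Some (set_reg s d (ram s (idx s x)))
  | RStore x a => Some (set_mem s (idx s x) (reg s a))
  end.

Definition eval_test (t : test) (s : state) : bool :=
  match t with
  | IEq x y => idx s x == idx s y
  | ILt x y => (idx s x < idx s y)%N
  | REq a b => reg s a == reg s b
  | RLt a b => reg s a < reg s b
  end.

(* [exec c s t s']: started in s, the program c halts in s' after exactly t
   steps.  Every instruction and every test counts as one step, index
   bookkeeping and memory accesses included, so t also bounds the number of
   real operations and comparisons alone. *)
Inductive exec : program -> state -> nat -> state -> Prop :=
| exec_skip s : exec Skip s 0 s
| exec_instr i s s' : eval_instr i s = Some s' -> exec (Instr i) s 1 s'
| exec_seq c1 c2 s s1 s2 t1 t2 :
    exec c1 s t1 s1 -> exec c2 s1 t2 s2 -> exec (Seq c1 c2) s (t1 + t2) s2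
| exec_if b c1 c2 s s' t :
    exec (if eval_test b s then c1 else c2) s t s' ->
    exec (If b c1 c2) s t.+1 s'
| exec_while_false b c s :
    ~~ eval_test b s -> exec (While b c) s 1 s
| exec_while_true b c s s1 s2 t1 t2 :
    eval_test b s -> exec c s t1 s1 -> exec (While b c) s1 t2 s2 ->
    exec (While b c) s (t1 + t2).+1 s2.

Lemma exec_det c s t1 s1 t2 s2 :
  exec c s t1 s1 -> exec c s t2 s2 -> t1 = t2 /\ s1 = s2.
Proof.
move=> e; elim: e t2 s2 => {c s t1 s1}.
- by move=> s t2 s2 e; inversion e.
- move=> i s s' Es t2 s2 e; inversion e as [|? ? ? Es'| | | |]; subst.
  by move: Es'; rewrite Es => -[].
- move=> c1 c2 s s1 s2 t1 t2 _ IH1 _ IH2 t s' e.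
  inversion e as [| |? ? ? u ? ? ? e1 e2| | |]; subst.
  have [? ?] := IH1 _ _ e1; subst.
  by have [-> ->] := IH2 _ _ e2.
- move=> b c1 c2 s s' t _ IH t2 s2 e.
  inversion e as [| | |? ? ? ? ? ? e1| |]; subst.
  by have [-> ->] := IH _ _ e1.
- move=> b c s nb t2 s2 e.
  inversion e as [| | | |? ? ? nb'|? ? ? ? ? ? ? b']; subst => //.
  by rewrite b' in nb.
- move=> b c s s1 s2 t1 t2 bt _ IH1 _ IH2 t s' e.
  inversion e as [| | | |? ? ? nb|? ? ? ? ? ? ? _ e1 e2]; subst.
    by rewrite bt in nb.
  have [? ?] := IH1 _ _ e1; subst.
  by have [-> ->] := IH2 _ _ e2.
Qed.

(* Index register 0 holds the length of the input list, the memory its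
   entries; everything else is zero. *)
Definition initial (l : seq R) : state :=
  State [eta (fun=> 0%N) with 0%N |-> size l] (fun=> 0) (nth 0 l).

(* The answer is yes when index register 0 is nonzero at the end. *)
Definition accepts (s : state) : bool := idx s 0%N != 0%N.

Definition decides_in (c : program) (l : seq R) (bound : nat) (P : Prop) :=
  exists t s, [/\ exec c (initial l) t s, (t <= bound)%N & accepts s <-> P].

End Semantics.

(* Main.v *)
Require Import Defs.
From HB Require Import structures.
From mathcomp Require Import all_boot all_order all_algebra all_fingroup.
From mathcomp Require Import all_classical all_reals all_analysis.
From mathcomp Require Import ring lra zify.

Set Implicit Arguments.
Unset Strict Implicit.
Unset Printing Implicit Defensive.

Import Order.TTheory GRing.Theory Num.Theory numFieldNormedType.Exports.
Local Open Scope ring_scope.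

(* A configuration q with the same distances as p yields a bijection psi from
   the edges of the complete graph on p to those of q that preserves lengths.
   Four points of q lie in a plane, so the Cayley-Menger polynomial vanishes on
   the six edges between them, hence on their preimages in p.  For generic p
   this forbids that two edges sharing a vertex come from opposite edges of a
   4-subset of q, and that three edges at a vertex come from a triangle of q;
   so psi maps stars into stars, is induced by a permutation of the points, and
   p and q are congruent.  Omega consists of the p for which none of the
   Cayley-Menger values in question vanishes.  Fixing two edges with a common
   vertex and four more edges takes 3 + 4 * 2 = 11 indices, whence O(n^11).

   Omega is dense because none of the polynomials is zero.  If u has degree 1
   or 2 in the graph of the six edges, sending u to infinity gives a nonzero
   leading coefficient; if no vertex has degree 1 or 2, the six edges form a K4
   and the leading coefficient is the value of the form at the indicator of
   the star of a vertex, which is nonzero for these wrong labellings. *)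

(** * The Cayley-Menger polynomial of a tetrahedron *)

Section CayleyMenger.
Variable A : comPzRingType.
Implicit Types a b c x y : A.

(* 144 times the squared volume of a tetrahedron with squared edge lengths
   a = 12, a' = 34, b = 13, b' = 24, c = 14, c' = 23. *)
Definition cm a a' b b' c c' : A :=
  a * a' * (b + b' + c + c' - a - a') + b * b' * (a + a' + c + c' - b - b') +
  c * c' * (a + a' + b + b' - c - c') -
  a * b * c' - a * b' * c - a' * b * c - a' * b' * c'.

Definition sqd n (p : 'M[A]_(2, n)) (i j : 'I_n) : A :=
  (p 0 i - p 0 j) ^+ 2 + (p 1 i - p 1 j) ^+ 2.

Lemma sqdC n (p : 'M[A]_(2, n)) i j : sqd p i j = sqd p j i.
Proof. by rewrite /sqd; ring. Qed.

(* The partial derivative of cm in a; the others follow by symmetry. *)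
Definition cm' a a' b b' c c' : A :=
  a' * (b + b' + c + c' - a - a') - a * a' + b * b' + c * c' - b * c' - b' * c.

(** Four points of a plane span a flat tetrahedron, of volume zero; in coordinates this is a
    polynomial identity. *)
Lemma cm_planar n (p : 'M[A]_(2, n)) i j k l :
  cm (sqd p i j) (sqd p k l) (sqd p i k) (sqd p j l) (sqd p i l) (sqd p j k)
  = 0.
Proof. by rewrite /cm /sqd; ring. Qed.

End CayleyMenger.

(** * Leading coefficients along a vertex going to infinity *)

Section Leading.
Variable R : realFieldType.

(** The values [t = 0, 1, 2, 3] give four distinct roots 0, 1, 4, 9 of a cubic in [t ^+ 2]. *)
Lemma cubic_root4 (c0 c1 c2 c3 : R) :
  (forall t : R, c0 + c1 * t ^+ 2 + c2 * t ^+ 4 + c3 * t ^+ 6 = 0) ->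
  c2 = 0 /\ c3 = 0.
Proof.
move=> H; have := H 0; have := H 1; have := H 2; have := H 3.
rewrite !expr0n !expr1n /=.
by move=> h3 h2 h1 h0; split; lra.
Qed.

(* s marks the edges at the vertex that is sent to infinity, at distance t from
   the line of the other points. *)
Lemma cm_leading (s : 6.-tuple bool) (k : 6.-tuple R) :
  let d t i := (nth false s i)%:R * t ^+ 2 + nth 0 k i in
  all (fun x => 0 < x) k ->
  (forall t, cm (d t 0%N) (d t 1%N) (d t 2%N) (d t 3%N) (d t 4%N) (d t 5%N) = 0) ->
  (count id s \notin [:: 1; 2]%N) /\
  let e i : R := (nth false s i)%:R in
  cm (e 0%N) (e 1%N) (e 2%N) (e 3%N) (e 4%N) (e 5%N) = 0.
Proof.
case: s => -[//|s0 [//|s1 [//|s2 [//|s3 [//|s4 [//|s5 [|//]]]]]]] hs.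
case: k => -[//|k0 [//|k1 [//|k2 [//|k3 [//|k4 [//|k5 [|//]]]]]]] hk.
move=> d /=; rewrite {}/d /= {hs hk} => /and5P[p0 p1 p2 p3 /and3P[p4 p5 _]].
set S0 := s0%:R : R; set S1 := s1%:R : R; set S2 := s2%:R : R.
set S3 := s3%:R : R; set S4 := s4%:R : R; set S5 := s5%:R : R.
move=> H.
(* Expansion of the cubic form in [T = t ^+ 2]: the coefficient of [T] is its derivative at [k]
   along [s], that of [T ^+ 2] its derivative at [s] along [k], that of [T ^+ 3] its value at
   [s]. *)
have [|c2 c3] := @cubic_root4 (cm k0 k1 k2 k3 k4 k5)
  (S0 * cm' k0 k1 k2 k3 k4 k5 + S1 * cm' k1 k0 k2 k3 k5 k4 +
   S2 * cm' k2 k3 k0 k1 k4 k5 + S3 * cm' k3 k2 k0 k1 k5 k4 +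
   S4 * cm' k4 k5 k2 k3 k0 k1 + S5 * cm' k5 k4 k2 k3 k1 k0)
  (k0 * cm' S0 S1 S2 S3 S4 S5 + k1 * cm' S1 S0 S2 S3 S5 S4 +
   k2 * cm' S2 S3 S0 S1 S4 S5 + k3 * cm' S3 S2 S0 S1 S5 S4 +
   k4 * cm' S4 S5 S2 S3 S0 S1 + k5 * cm' S5 S4 S2 S3 S1 S0)
  (cm S0 S1 S2 S3 S4 S5).
  by move=> t; rewrite -(H t) /cm /cm'; ring.
split=> //; apply/negP => hc; clear H.
move: c2 c3; rewrite {}/S0 {}/S1 {}/S2 {}/S3 {}/S4 {}/S5 /cm /cm'.
(* Two opposite marked edges give the leading value -2. For one marked edge, or two on a common
   face, [c2] says that one of the positive [k] is zero: that of the opposite edge, or of the third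
   edge of the face. *)
by case: s0 hc => /=; case: s1 => /=; case: s2 => /=; case: s3 => /=;
  case: s4 => /=; case: s5 => //= _ c2 c3; lra.
Qed.

End Leading.

(* If all degrees are 0 or at least 3, then at most 4 vertices are incident to
   the 6 = 'C(4, 2) edges, which therefore form a K4. *)
Lemma degree_six_edges (T : finType) (E : seq {set T}) (u0 : T) :
    uniq E -> size E = 6%N -> all (fun A : {set T} => #|A| == 2%N) E ->
    (0 < count (fun A : {set T} => u0 \in A) E)%N ->
  (exists u, count (fun A : {set T} => u \in A) E \in [:: 1; 2]%N) \/
  count (fun A : {set T} => u0 \in A) E = 3%N.
Proof.
move=> uE sE cE d0; pose deg u := count (fun A : {set T} => u \in A) E.
have [[u hu]|no12] := pselect (exists u, deg u \in [:: 1; 2]%N).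
  by left; exists u.
right; pose S := [set u | 0 < deg u]%N.
have deg3 u : u \in S -> (2 < deg u)%N.
  rewrite inE => du; rewrite ltnNge; apply/negP => du2; apply: no12.
  by exists u; rewrite !inE; lia.
have ES A : A \in E -> A \in [set A : {set T} | A \subset S & #|A| == 2%N].
  move=> AE; rewrite inE (allP cE) // andbT; apply/fintype.subsetP => v vA.
  by rewrite inE /deg -has_count; apply/hasP; exists A.
have cS : (6 <= 'C(#|S|, 2))%N.
  rewrite -cards_draws -sE cardE.
  by apply: uniq_leq_size => // A /ES; rewrite mem_enum.
have sumdeg : (\sum_(u in S) deg u = 12)%N.
  transitivity (\sum_u deg u)%N.
    rewrite [RHS](bigID (mem S)) /= [X in (_ + X)%N]big1 ?addn0 //.
    by move=> i; rewrite inE -eqn0Ngt => /eqP.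
  transitivity (\sum_(A <- E) #|A|)%N.
    under eq_bigr => u _ do rewrite /deg -sum1_count big_mkcond.
    rewrite exchange_big; apply: eq_bigr => A _.
    by rewrite -sum1_card [RHS]big_mkcond.
  rewrite big_seq (eq_bigr (fun=> 2%N)) => [|A AE]; last exact/eqP/(allP cE).
  by rewrite -big_seq big_const_seq count_predT sE.
have u0S : u0 \in S by rewrite inE.
have : (\sum_(u in S | u != u0) 3 <= \sum_(u in S | u != u0) deg u)%N.
  by apply: leq_sum => u /andP[/deg3].
rewrite sum_nat_const => H.
move: sumdeg; rewrite (bigD1 u0) //= => sumdeg.
have c1 : #|[pred u | (u \in S) && (u != u0)]|.+1 = #|S|.
  rewrite (cardD1 u0 S) u0S add1n; congr _.+1.
  by apply: eq_card => u; rewrite !inE andbC.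
have := deg3 _ u0S; rewrite -/(deg u0).
have : (3 < #|S|)%N.
  rewrite ltnNge; apply/negP => S3.
  by have := leq_trans cS (leq_bin2l 2 S3).
set c := #|[pred u | _]| in H c1; move: H sumdeg; set X := (\sum_(i in S | _) _)%N.
by move: c1; clearbody c X => *; lia.
Qed.

(** * Configurations at which the form does not vanish *)

Section Generic.
Variables (R : rcfType) (n : nat).
Implicit Types (e : 'I_n * 'I_n).

Definition edge e : {set 'I_n} := [set e.1; e.2].

Lemma edge_eq e f : (edge e == edge f) =
  ((e.1 == f.1) && (e.2 == f.2)) || ((e.1 == f.2) && (e.2 == f.1)).
Proof.
case: e f => [a b] [c d]; rewrite /edge /=.
apply/eqP/orP => [H|[/andP[/eqP-> /eqP->]|/andP[/eqP-> /eqP->]]] //; last first.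
  by rewrite finset.setUC.
have := set21 a b; rewrite H !inE => /orP[]/eqP ?;
have := set22 a b; rewrite H !inE => /orP[]/eqP ?;
have := set21 c d; rewrite -H !inE => /orP[]/eqP ?;
have := set22 c d; rewrite -H !inE => /orP[]/eqP ?;
by subst; rewrite ?eqxx; auto.
Qed.

(** [u] sits at height [t] above the origin and the other points at distinct positive abscissas, so
    distinct points stay apart even at [t = 0]. *)
Definition spread (u : 'I_n) (t : R) : 'M[R]_(2, n) :=
  \matrix_(k, i) if k == 0 then (if i == u then 0%N else i.+1)%:R
                 else (i == u)%:R * t.

Lemma sqd_spread (u : 'I_n) e : e.1 != e.2 ->
  exists2 k : R, 0 < k &
    forall t, sqd (spread u t) e.1 e.2 = (u \in edge e)%:R * t ^+ 2 + k.
Proof.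
case: e => i j /= ij.
have dist_gt0 (a b : nat) : a != b -> 0 < (a%:R - b%:R : R) ^+ 2.
  by move=> ab; rewrite exprn_even_gt0 //= subr_eq0 eqr_nat.
pose x (i : 'I_n) : nat := if i == u then 0%N else i.+1.
exists (((x i)%:R - (x j)%:R) ^+ 2).
  apply: dist_gt0; rewrite /x.
  by case: (eqVneq i u) ij => [->|_]; case: (eqVneq j u) => [?|_]; rewrite ?eqSS.
move=> t; rewrite /sqd !mxE /= !inE ![u == _]eq_sym /x.
move: ij; case: (eqVneq i u) => [->|_]; case: (eqVneq j u) => [?|_] //=;
  rewrite ?eqxx //= => _; ring.
Qed.

(** Were the form zero everywhere, [cm_leading] at each vertex would exclude degrees 1 and 2; the
    degree count then gives [u0] degree 3, where the leading coefficient contradicts the last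
    hypothesis. *)
Lemma cm_generic (e1 e2 e3 e4 e5 e6 : 'I_n * 'I_n) (u0 : 'I_n) :
    let E := [:: e1; e2; e3; e4; e5; e6] in
    let d e : R := (u0 \in edge e)%:R in
    all (fun e => e.1 != e.2) E -> uniq [seq edge e | e <- E] ->
    u0 \in edge e1 ->
    (count (fun e => u0 \in edge e) E = 3%N ->
     cm (d e1) (d e2) (d e3) (d e4) (d e5) (d e6) != 0) ->
  exists p : 'M[R]_(2, n),
    cm (sqd p e1.1 e1.2) (sqd p e2.1 e2.2) (sqd p e3.1 e3.2)
       (sqd p e4.1 e4.2) (sqd p e5.1 e5.2) (sqd p e6.1 e6.2) != 0.
Proof.
move=> E d nlE uE u0e1 H3; apply: contrapT => noP.
have key u : count (fun e => u \in edge e) E \notin [:: 1; 2]%N /\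
    let d e : R := (u \in edge e)%:R in
    cm (d e1) (d e2) (d e3) (d e4) (d e5) (d e6) = 0.
  move: nlE; rewrite /= => /and5P[n1 n2 n3 n4 /and3P[n5 n6 _]].
  have [k1 p1 h1] := sqd_spread u n1; have [k2 p2 h2] := sqd_spread u n2.
  have [k3 p3 h3] := sqd_spread u n3; have [k4 p4 h4] := sqd_spread u n4.
  have [k5 p5 h5] := sqd_spread u n5; have [k6 p6 h6] := sqd_spread u n6.
  have := @cm_leading R [tuple u \in edge e1; u \in edge e2; u \in edge e3;
    u \in edge e4; u \in edge e5; u \in edge e6] [tuple k1; k2; k3; k4; k5; k6].
  rewrite /= p1 p2 p3 p4 p5 p6 => -[] // t.
  apply/eqP/negPn/negP => ne; apply: noP.
  by exists (spread u t); rewrite h1 h2 h3 h4 h5 h6; exact: ne.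
have [] := @degree_six_edges _ [seq edge e | e <- E] u0 uE erefl.
- rewrite all_map; apply: sub_all nlE => e /= ne.
  by rewrite cards2 ne.
- by rewrite count_map /= u0e1.
- by case=> u; rewrite count_map => hu; have [] := key u; rewrite hu.
- by rewrite count_map => /H3; rewrite (key u0).2 eqxx.
Qed.
End Generic.

(** * Polynomial expressions in the coordinates of selected points *)

Inductive expr :=
| EVar of nat & bool
| EAdd of expr & expr
| ESub of expr & expr
| EMul of expr & expr.

Section Eval.
Variables (A : pzRingType).

(** The ring varies: real values define [Omega], values in [{poly R}] yield its density. The same
    terms are compiled into the program. *)
Fixpoint eval_expr (v : nat -> bool -> A) e : A :=
  match e with
  | EVar j k => v j k
  | EAdd e1 e2 => eval_expr v e1 + eval_expr v e2
  | ESub e1 e2 => eval_expr v e1 - eval_expr v e2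
  | EMul e1 e2 => eval_expr v e1 * eval_expr v e2
  end.

Lemma eq_eval_expr v w e : (forall j k, v j k = w j k) -> eval_expr v e = eval_expr w e.
Proof.
by move=> vw; elim: e => /= [j k|e1 -> e2 ->|e1 -> e2 ->|e1 -> e2 ->].
Qed.

Definition coord_of n (p : 'M[A]_(2, n)) (x : nat -> 'I_n) (j : nat) (k : bool) :=
  p (if k then 1 else 0) (x j).

Fixpoint vars_lt (m : nat) (e : expr) : bool :=
  match e with
  | EVar j _ => (j < m)%N
  | EAdd e1 e2 | ESub e1 e2 | EMul e1 e2 => vars_lt m e1 && vars_lt m e2
  end.

Lemma eq_eval_expr_lt m v w e : vars_lt m e ->
  (forall j k, (j < m)%N -> v j k = w j k) -> eval_expr v e = eval_expr w e.
Proof.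
move=> + vw; elim: e => /= [j k|e1 H1 e2 H2|e1 H1 e2 H2|e1 H1 e2 H2].
  exact: vw.
all: by move=> /andP[/H1-> /H2->].
Qed.

End Eval.

Lemma rmorph_eval_expr (A B : pzRingType) (f : {rmorphism A -> B})
    (v : nat -> bool -> A) e :
  f (eval_expr v e) = eval_expr (fun j k => f (v j k)) e.
Proof.
by elim: e => //= e1 <- e2 <-; rewrite ?rmorphB ?rmorphD ?rmorphM.
Qed.

(** * Open dense sets cut out by nonvanishing polynomials *)

Section OpenDense.
Local Open Scope classical_set_scope.

Lemma open_dense_forall (T : topologicalType) (I : finType) (P : I -> set T) :
    (forall i, open (P i) /\ dense (P i)) ->
  open [set p | forall i, P i p] /\ dense [set p | forall i, P i p].
Proof.
move=> odP; rewrite (_ : [set p | _] =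
    [set p | forall i, i \in enum I -> P i p]).
  elim: (enum I) => [|i s [os ds]].
    rewrite (_ : [set p | _] = setT); last by apply/seteqP; split.
    by split; [exact: openT|move=> O O0 _; rewrite setIT].
  rewrite (_ : [set p | _] = P i `&` [set p | forall i, i \in s -> P i p]).
    by split; [apply: openI|apply: denseI] => //; case: (odP i).
  apply/seteqP; split=> p /=.
    by move=> H; split=> [|j js]; apply: H; rewrite inE ?eqxx ?js ?orbT.
  by case=> Pi Ps j; rewrite inE => /orP[/eqP->|/Ps].
by apply/seteqP; split=> p /= H i; [move=> _; exact: H|apply: H; rewrite mem_enum].
Qed.

Variables (R : realType) (n : nat).
Implicit Types (p q : 'M[R]_(2, n)) (x : nat -> 'I_n).

Lemma continuous_eval_expr x e : continuous (fun p => eval_expr (coord_of p x) e).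
Proof.
elim: e => /= [j k p|e1 IH1 e2 IH2 p|e1 IH1 e2 IH2 p|e1 IH1 e2 IH2 p].
- exact: coord_continuous.
- exact: continuousD (IH1 p) (IH2 p).
- exact: continuousB (IH1 p) (IH2 p).
- exact: continuousM (IH1 p) (IH2 p).
Qed.

Lemma open_eval_expr_neq0 x e :
  open [set p : 'M[R]_(2, n) | eval_expr (coord_of p x) e != 0].
Proof.
apply: (@open_comp _ _ (fun p => eval_expr (coord_of p x) e) [set y | y != 0]).
  by move=> p _; exact: continuous_eval_expr.
exact: open_neq.
Qed.

(* On the line through p and a point q where the polynomial does not vanish,
   it has finitely many zeros. *)
Lemma dense_eval_expr_neq0 x e q : eval_expr (coord_of q x) e != 0 ->
  dense [set p : 'M[R]_(2, n) | eval_expr (coord_of p x) e != 0].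
Proof.
move=> eq0 O [p Op] oO.
pose line (t : R) := p + t *: (q - p).
pose P := eval_expr (A := {poly R}) (fun j k =>
  (coord_of p x j k)%:P + (coord_of (q - p) x j k)%:P * 'X) e.
have PE t : P.[t] = eval_expr (coord_of (line t) x) e.
  rewrite -/(horner_eval t P) rmorph_eval_expr; apply: eq_eval_expr => j k.
  by rewrite /= /horner_eval !hornerE /line /coord_of !mxE mulrC.
have P0 : P != 0.
  apply: contraNneq eq0 => P0; have := PE 1.
  by rewrite P0 horner0 /line scale1r addrC subrK => <-.
have cline : {for 0, continuous line}.
  by apply: cvgD; [exact: cvg_cst|apply: cvgZr_tmp; exact: cvg_id].
have : nbhs 0 (line @^-1` O).
  by apply: cline; apply: open_nbhs_nbhs; split=> //; rewrite /line scale0r addr0.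
move=> /nbhs_ballP[eps /= eps0 epsO].
(* [P] has fewer than [size P] roots, so one of these [size P] distinct parameters is not a root;
   the shift to [k.+2] keeps them strictly below [eps]. *)
pose s := [seq eps / k.+2%:R | k <- iota 0 (size P)].
have us : uniq s.
  rewrite map_inj_uniq ?iota_uniq // => i j /(mulfI (lt0r_neq0 eps0)) /invr_inj.
  by move/eqP; rewrite eqr_nat !eqSS => /eqP.
have : ~~ all (root P) s.
  apply/negP => /(max_poly_roots P0) /(_ us).
  by rewrite size_map size_iota ltnn.
move=> /allPn[_ /mapP[k _ ->]] nr.
exists (line (eps / k.+2%:R)); split; last by rewrite /= -PE.
apply: epsO; rewrite /ball /= sub0r normrN gtr0_norm ?divr_gt0 //.
by rewrite ltr_pdivrMr // ltr_pMr // ltr1n.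
Qed.

End OpenDense.

(** * The set [Omega] and its topology *)

Section Omega.
Local Open Scope classical_set_scope.

(** The first two edges share the point 0, so six edges use eleven indices instead of twelve. *)
Definition edges : seq (nat * nat) :=
  [:: (0, 1); (0, 2); (3, 4); (5, 6); (7, 8); (9, 10)]%N.

(* The pairs of equalities of indices that express that two of the edges are
   equal, or that one is a loop. *)
Fixpoint clashes (es : seq (nat * nat)) : seq ((nat * nat) * (nat * nat)) :=
  if es is e :: es' then
    (e, e) ::
    [seq ((e.1, f.1), (e.2, f.2)) | f <- es'] ++
    [seq ((e.1, f.2), (e.2, f.1)) | f <- es'] ++ clashes es'
  else [::].

Definition clash (T : eqType) (x : nat -> T) (c : (nat * nat) * (nat * nat)) :=
  (x c.1.1 == x c.1.2) && (x c.2.1 == x c.2.2).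

Definition sqdE (e : nat * nat) : expr :=
  let d k := ESub (EVar e.1 k) (EVar e.2 k) in
  EAdd (EMul (d false) (d false)) (EMul (d true) (d true)).

Definition cmE a a' b b' c c' : expr :=
  let: s := EAdd (EAdd (EAdd a a') (EAdd b b')) (EAdd c c') in
  let term x x' := EMul (EMul x x') (ESub (ESub s (EAdd x x)) (EAdd x' x')) in
  ESub (EAdd (EAdd (term a a') (term b b')) (term c c'))
    (EAdd (EAdd (EMul (EMul a b) c') (EMul (EMul a b') c))
         (EAdd (EMul (EMul a' b) c) (EMul (EMul a' b') c'))).

Lemma eval_cmE (A : comPzRingType) (v : nat -> bool -> A) a a' b b' c c' :
  eval_expr v (cmE a a' b b' c c') = cm (eval_expr v a) (eval_expr v a') (eval_expr v b)
    (eval_expr v b') (eval_expr v c) (eval_expr v c').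
Proof. by rewrite /cmE /cm /=; ring. Qed.

Lemma eval_sqdE (A : comPzRingType) n (p : 'M[A]_(2, n)) x e :
  eval_expr (coord_of p x) (sqdE e) = sqd p (x e.1) (x e.2).
Proof. by rewrite /sqd !expr2. Qed.

(* The first two edges share the point 0 but are in opposite position. *)
Definition adjacentE : expr :=
  cmE (sqdE (0, 1)%N) (sqdE (0, 2)%N) (sqdE (3, 4)%N) (sqdE (5, 6)%N) (sqdE (7, 8)%N)
      (sqdE (9, 10)%N).

(* The edges (0, 1), (0, 2), (3, 4) are in the position of a face; when the
   points 0 and 3 coincide they share a vertex instead. *)
Definition starE : expr :=
  cmE (sqdE (0, 1)%N) (sqdE (9, 10)%N) (sqdE (0, 2)%N) (sqdE (7, 8)%N) (sqdE (5, 6)%N)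
      (sqdE (3, 4)%N).

Lemma eval_adjacentE (A : comPzRingType) n (p : 'M[A]_(2, n)) x :
  eval_expr (coord_of p x) adjacentE =
  cm (sqd p (x 0%N) (x 1%N)) (sqd p (x 0%N) (x 2%N)) (sqd p (x 3%N) (x 4%N))
     (sqd p (x 5%N) (x 6%N)) (sqd p (x 7%N) (x 8%N)) (sqd p (x 9%N) (x 10%N)).
Proof. by rewrite /adjacentE eval_cmE !eval_sqdE. Qed.

Lemma eval_starE (A : comPzRingType) n (p : 'M[A]_(2, n)) x :
  eval_expr (coord_of p x) starE =
  cm (sqd p (x 0%N) (x 1%N)) (sqd p (x 9%N) (x 10%N)) (sqd p (x 0%N) (x 2%N))
     (sqd p (x 7%N) (x 8%N)) (sqd p (x 5%N) (x 6%N)) (sqd p (x 3%N) (x 4%N)).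
Proof. by rewrite /starE eval_cmE !eval_sqdE. Qed.

(** [T] and [v] are abstract so that one definition serves for points of ['I_n] and for memory
    addresses. Labellings with a loop or a repeated edge are let through, as the form may vanish
    identically on them. *)
Definition degenerate (R : pzRingType) (T : eqType) (v : nat -> bool -> R)
    (x : nat -> T) :=
  ~~ has (clash x) (clashes edges) &&
  ((eval_expr v adjacentE == 0) || (x 3%N == x 0%N) && (eval_expr v starE == 0)).

(** The first component serves as the default of [nth], since ['I_n] has no canonical element. *)
Definition Omega (R : pzRingType) (n : nat) : set 'M[R]_(2, n) :=
  [set p | forall ub : 'I_n * 11.-tuple 'I_n,
    let x := nth ub.1 ub.2 in ~~ degenerate (coord_of p x) x].

Lemma has_clash n (x : nat -> 'I_n) es :
  ~~ has (clash x) (clashes es) =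
  all (fun e => x e.1 != x e.2) es && uniq [seq edge (x e.1, x e.2) | e <- es].
Proof.
elim: es => //= e es IH.
pose m1 := [seq ((e.1, f.1), (e.2, f.2)) | f <- es].
pose m2 := [seq ((e.1, f.2), (e.2, f.1)) | f <- es].
have E1 : has (clash x) m1 || has (clash x) m2 =
    (edge (x e.1, x e.2) \in [seq edge (x f.1, x f.2) | f <- es]).
  rewrite -has_pred1 !has_map -has_predU; apply: eq_has => f /=.
  by rewrite /clash /= [RHS]eq_sym edge_eq.
rewrite {1}/clash andbb negb_or !has_cat orbA E1 negb_or IH -andbA.
by congr andb; rewrite andbCA.
Qed.

Variables (R : realType) (n : nat).

Lemma adjacentE_neq0 (x : nat -> 'I_n) : ~~ has (clash x) (clashes edges) ->
  exists p : 'M[R]_(2, n), eval_expr (coord_of p x) adjacentE != 0.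
Proof.
rewrite has_clash => /andP[nl uE].
have [||||p Hp] := @cm_generic R n (x 0%N, x 1%N) (x 0%N, x 2%N) (x 3%N, x 4%N)
  (x 5%N, x 6%N) (x 7%N, x 8%N) (x 9%N, x 10%N) (x 0%N).
- exact: nl.
- exact: uE.
- exact: set21.
(* At degree 3 exactly one other edge meets the vertex, and the form is -1 at each of the four
   possible indicators. *)
- rewrite /= !(set21 (x 0%N)).
  case: (_ \in _); case: (_ \in _); case: (_ \in _); case: (_ \in _) => // _;
  by rewrite /cm /=; apply/eqP => h; lra.
by exists p; rewrite eval_adjacentE.
Qed.

Lemma starE_neq0 (x : nat -> 'I_n) :
  ~~ has (clash x) (clashes edges) -> x 3%N = x 0%N ->
  exists p : 'M[R]_(2, n), eval_expr (coord_of p x) starE != 0.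
Proof.
rewrite has_clash => /andP[nl uE] x30.
have [||||p Hp] := @cm_generic R n (x 0%N, x 1%N) (x 9%N, x 10%N) (x 0%N, x 2%N) 
  (x 7%N, x 8%N) (x 5%N, x 6%N) (x 3%N, x 4%N) (x 0%N).
- by move: nl => /= /and5P[-> -> -> -> /and3P[-> -> _]].
- rewrite -(perm_uniq (s1 := [seq edge (x e.1, x e.2) | e <- edges])) //.
  by apply/seq.permP => P /=; lia.
- exact: set21.
(* At degree 3 the edges at the vertex are those in the positions [a], [b], [c'] of a face, where
   only the term [- a * b * c'] remains. *)
- rewrite /= {}x30 {nl uE} !(set21 (x 0%N)).
  case: (_ \in _); case: (_ \in _); case: (_ \in _) => // _.
  by rewrite /cm /=; apply/eqP => h; lra.
by exists p; rewrite eval_starE.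
Qed.

Lemma nondegenerate_open_dense (x : nat -> 'I_n) :
  let U := [set p : 'M[R]_(2, n) | ~~ degenerate (coord_of p x) x] in
  open U /\ dense U.
Proof.
rewrite /degenerate; have [cl|ncl] /= := boolP (has _ _).
  rewrite (_ : [set p | _] = setT); last by apply/seteqP; split.
  by split; [exact: openT|move=> O O0 _; rewrite setIT].
have [p1 h1] := adjacentE_neq0 ncl.
have oA := @open_eval_expr_neq0 R n x adjacentE.
have dA := dense_eval_expr_neq0 h1.
have [x30|_] := eqVneq (x 3%N) (x 0%N) => /=; last first.
  rewrite (_ : [set p | _] = [set p | eval_expr (coord_of p x) adjacentE != 0]) //.
  by apply/seteqP; split=> p /=; rewrite orbF.
have [p2 h2] := starE_neq0 ncl x30.
have oB := @open_eval_expr_neq0 R n x starE.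
have dB := dense_eval_expr_neq0 h2.
rewrite (_ : [set p | _] = [set p | eval_expr (coord_of p x) adjacentE != 0] `&`
                           [set p | eval_expr (coord_of p x) starE != 0]).
  by split; [exact: openI|exact: denseI].
by apply/seteqP; split=> p /=; rewrite negb_or => /andP.
Qed.

Lemma Omega_open_dense : open (@Omega R n) /\ dense (@Omega R n).
Proof.
by apply: open_dense_forall => -[u b]; exact: nondegenerate_open_dense.
Qed.

End Omega.

(* Register conventions: index registers 1, 2 and 6 hold the constants 1, 2 and
   0, index register 4 is set when a degeneracy has been found, 3 and 5 are
   scratch, and index register 10 + j holds the address 2 i of the abscissa of
   the j-th selected point i; real register 2 j + k holds its coordinate k, and
   real register 22 holds 0. *)

Fixpoint straight (c : program) : bool :=
  match c with
  | Instr (ROp RDiv _ _ _) | While _ _ => false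
  | Skip | Instr _ => true
  | Seq c1 c2 | If _ c1 c2 => straight c1 && straight c2
  end.

Fixpoint cost (c : program) : nat :=
  match c with
  | Skip | While _ _ => 0
  | Instr _ => 1
  | Seq c1 c2 => cost c1 + cost c2
  | If _ c1 c2 => (cost c1 + cost c2).+1
  end.

Fixpoint load_points (m : nat) : program :=
  if m is j.+1 then
    Seq (load_points j)
      (Seq (Instr (RLoad (2 * j) (10 + j)))
        (Seq (Instr (IAdd 3 (10 + j) 1)) (Instr (RLoad (2 * j).+1 3))))
  else Skip.

Fixpoint find_clash (cs : seq ((nat * nat) * (nat * nat))) : program :=
  if cs is c :: cs' then
    Seq (If (IEq (10 + c.1.1) (10 + c.1.2))
           (If (IEq (10 + c.2.1) (10 + c.2.2)) (Instr (IConst 5 1)) Skip) Skip)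
      (find_clash cs')
  else Skip.

(** Stack discipline: the value ends in register [r] and intermediate results lie above it. A
    variable is copied by adding the zero of register 22. *)
Fixpoint compile (e : expr) (r : nat) : program :=
  let bin o e1 e2 :=
    Seq (compile e1 r) (Seq (compile e2 r.+1) (Instr (ROp o r r r.+1))) in
  match e with
  | EVar j k => Instr (ROp RAdd r (2 * j + k) 22)
  | EAdd e1 e2 => bin RAdd e1 e2
  | ESub e1 e2 => bin RSub e1 e2
  | EMul e1 e2 => bin RMul e1 e2
  end.

Definition reject_if_zero (r : nat) : program :=
  If (REq r 22) (Instr (IConst 4 1)) Skip.

(** The second form is computed from register 24 on, which preserves the value of the first in 23.
    Index registers 13 and 10 hold the addresses of the points 3 and 0. *)
Definition check_tuple : program :=
  Seq (load_points 11)
  (Seq (Instr (IConst 5 0))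
  (Seq (find_clash (clashes edges))
  (Seq (compile adjacentE 23)
  (Seq (compile starE 24)
    (If (IEq 5 6)
      (Seq (reject_if_zero 23) (If (IEq 13 10) (reject_if_zero 24) Skip))
      Skip))))).

(** The counter is itself an address: it runs through the even numbers below the input length
    [2 * n] held in index register 0. *)
Definition loop (j : nat) (c : program) : program :=
  Seq (Instr (IConst (10 + j) 0))
    (While (ILt (10 + j) 0) (Seq c (Instr (IAdd (10 + j) (10 + j) 2)))).

Fixpoint nest (j : nat) (c : program) : program :=
  if j is j'.+1 then nest j' (loop j' c) else c.

Definition decide_Omega : program :=
  Seq (Instr (IConst 1 1))
  (Seq (Instr (IConst 2 2))
  (Seq (nest 11 check_tuple)
    (If (IEq 4 6) (Instr (IConst 0 1)) (Instr (IConst 0 0))))).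

(** * Semantics of loop-free programs *)

Section StraightLine.
Variable R : realType.
Implicit Types s : state R.

Fixpoint sem (c : program) s : state R :=
  match c with
  | Skip | While _ _ => s
  | Instr i => odflt s (eval_instr i s)
  | Seq c1 c2 => sem c2 (sem c1 s)
  | If b c1 c2 => if eval_test b s then sem c1 s else sem c2 s
  end.

(** Without loops and divisions a run neither diverges nor fails, so the total function [sem] gives
    its final state. *)
Lemma exec_sem c s : straight c ->
  exists2 t, (t <= cost c)%N & exec c s t (sem c s).
Proof.
elim: c s => [|i|c1 IH1 c2 IH2|b c1 IH1 c2 IH2|//] s /=.
- by exists 0%N => //; exact: exec_skip.
- move=> si; exists 1%N => //; apply: exec_instr.
  by case: i si => [||||[]||].
- move=> /andP[/(IH1 s)[t1 le1 e1] /(IH2 (sem c1 s))[t2 le2 e2]].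
  by exists (t1 + t2)%N; [exact: leq_add|exact: exec_seq e1 e2].
- move=> /andP[/(IH1 s)[t1 le1 e1] /(IH2 s)[t2 le2 e2]].
  exists (if eval_test b s then t1 else t2).+1.
    by rewrite ltnS; case: ifP => _; lia.
  by apply: exec_if; case: ifP.
Qed.

Lemma sem_load_points m s : idx s 1%N = 1%N ->
  let s' := sem (load_points m) s in
  [/\ ram s' = ram s, forall y, y != 3%N -> idx s' y = idx s y,
      forall r, (2 * m <= r)%N -> reg s' r = reg s r &
      forall j (k : bool), (j < m)%N ->
        reg s' (2 * j + k)%N = ram s (idx s (10 + j) + k)%N].
Proof.
move=> s1; elim: m => [//|m /= [rE iE gE lE]]; split=> //.
- by move=> y y3; rewrite (negPf y3) iE.
- by move=> r hr; rewrite !ifF ?gE //; lia.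
move=> j k; rewrite ltnS leq_eqVlt => /orP[/eqP->|jm].
  case: k; first by rewrite addn1 eqxx rE !iE // s1.
  by rewrite !addn0 ifF ?eqxx ?rE ?iE //; lia.
by rewrite !ifF ?lE //; case: k; lia.
Qed.

Lemma sem_find_clash cs s :
  let s' := sem (find_clash cs) s in
  [/\ ram s' = ram s, reg s' = reg s, forall y, y != 5%N -> idx s' y = idx s y &
      (idx s' 5%N == 0%N) =
        (idx s 5%N == 0%N) && ~~ has (clash (fun j => idx s (10 + j))) cs].
Proof.
elim: cs s => [|c cs IH] s; first by split=> //=; rewrite andbT.
rewrite /=; set s1 := (X in sem (find_clash cs) X).
have s1E : s1 = if clash (fun j => idx s (10 + j)%N) c then set_idx s 5 1 else s.
  by rewrite /s1 /clash; case: (idx s _ == _) => //=.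
have [-> -> iE ->] := IH s1; clearbody s1; rewrite {s1}s1E in iE *.
case: (clash _ c) iE => iE; split; rewrite ?andbF //= => y y5.
by rewrite iE //= (negPf y5).
Qed.

(** The coordinates occupy registers 0 to 21 and the constant zero register 22; working above 22
    leaves them intact for the second operand. *)
Lemma sem_compile e r s : reg s 22%N = 0 -> (22 < r)%N -> vars_lt 11 e ->
  let s' := sem (compile e r) s in
  [/\ idx s' = idx s, ram s' = ram s,
      forall q, (q < r)%N -> reg s' q = reg s q &
      reg s' r = eval_expr (fun j k => reg s (2 * j + k)%N) e].
Proof.
move=> + + +; elim: e r s => [j k|e1 IH1 e2 IH2|e1 IH1 e2 IH2|e1 IH1 e2 IH2] r s s0 hr /=.
  move=> j11; split=> //; first by move=> q qr; rewrite ifF //; lia.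
  by rewrite eqxx s0 addr0.
all: move=> /andP[v1 v2]; have [i1 m1 g1 r1] := IH1 r s s0 hr v1.
all: set s1 := sem _ s in i1 m1 g1 r1 *.
all: have [||i2 m2 g2 r2] := IH2 r.+1 s1 _ _ v2; [by rewrite g1|lia|].
all: split; rewrite ?i2 ?m2 //=.
all: try by move=> q qr; rewrite ifF ?g2 ?g1 //; lia.
all: rewrite eqxx r2 g2 // r1; congr (_ _ _); try congr (- _).
all: apply: eq_eval_expr_lt v2 _ => j k j11; rewrite g1 //; case: k; lia.
Qed.

End StraightLine.

(** * Correctness and running time of the search *)

Section Deciding.
Variables (R : realType) (n : nat) (l : seq R).
Hypothesis size_l : size l = (2 * n)%N.
Implicit Types s : state R.

Definition degenerate_at (a : seq nat) :=
  degenerate (fun j k => nth 0 l (nth 0 a j + k)) (nth 0 a).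

Definition consistent s :=
  [/\ idx s 0%N = (2 * n)%N, idx s 1%N = 1%N & idx s 2%N = 2%N] /\
  [/\ idx s 6%N = 0%N, reg s 22%N = 0 & ram s = nth 0 l].

Lemma straight_check_tuple : straight check_tuple.
Proof. by []. Qed.

Lemma sem_check_tuple s : consistent s ->
  let s' := sem check_tuple s in
  [/\ consistent s', forall y, (10 <= y)%N -> idx s' y = idx s y &
      (idx s' 4%N != 0%N) =
        (idx s 4%N != 0%N) || degenerate_at [seq idx s y | y <- iota 10 11]].
Proof.
move=> [[s0 s1 s2] [s6 sr sm]].
have := @sem_compile R starE 24; have := @sem_compile R adjacentE 23.
have := @sem_find_clash R (clashes edges); have := sem_load_points 11 s1.
rewrite /check_tuple; move: (load_points 11) (find_clash _) (compile _ 23)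
  (compile _ 24) => load clsh ca cs [m1 i1 g1 l1] specC specA specS.
rewrite [sem _ _]/=; set t1 := sem load s in m1 i1 g1 l1 *; clearbody t1.
set t2 := set_idx t1 5 0.
have [m3 g3 i3 b3] := specC t2; set t3 := sem clsh t2 in m3 g3 i3 b3 *.
clearbody t3.
have r3 : reg t3 22%N = 0 by rewrite g3 /= g1.
have [i4 m4 g4 r4] := specA t3 r3 isT isT.
set t4 := sem ca t3 in i4 m4 g4 r4 *; clearbody t4.
have r22 : reg t4 22%N = 0 by rewrite g4.
have [i5 m5 g5 r5] := specS t4 r22 isT isT.
set t5 := sem cs t4 in i5 m5 g5 r5 *; clearbody t5.
have i5E y : y != 3%N -> y != 5%N -> idx t5 y = idx s y.
  by move=> y3 y5; rewrite i5 i4 i3 //= (negPf y5) i1.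
have m5E : ram t5 = nth 0 l by rewrite m5 m4 m3 /= m1.
have r5E : reg t5 22%N = 0 by rewrite g5.
pose x := nth 0%N [seq idx s y | y <- iota 10 11].
have xE j : (j < 11)%N -> x j = idx s (10 + j)%N.
  by move=> j11; rewrite /x (nth_map 0%N) ?size_iota // nth_iota.
have coords j (k : bool) : (j < 11)%N ->
    reg t3 (2 * j + k)%N = nth 0 l (x j + k).
  by move=> j11; rewrite g3 /= l1 // sm xE.
have adjE : reg t5 23%N = eval_expr (fun j k => nth 0 l (x j + k)) adjacentE.
  by rewrite g5 // r4; apply: (@eq_eval_expr_lt _ 11).
have starEE : reg t5 24%N = eval_expr (fun j k => nth 0 l (x j + k)) starE.
  rewrite r5; apply: (@eq_eval_expr_lt _ 11) => // j k j11.
  by rewrite g4 ?coords //; case: k; lia.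
have clashE : (idx t5 5%N == 0%N) = ~~ has (clash x) (clashes edges).
  by rewrite i5 i4 b3 /= /clash /x /= !i1.
have x30 : (x 3 == x 0)%N = (idx t5 13 == idx t5 10)%N by rewrite !i5E // !xE.
rewrite /degenerate_at /degenerate -/x -adjE -starEE -clashE x30.
have c5 : consistent t5 by split; split; rewrite ?i5E.
have i10 y : (10 <= y)%N -> idx t5 y = idx s y by move=> y10; rewrite i5E //; lia.
have t6 : (idx t5 5 == 0)%N = (idx t5 5 == idx t5 6)%N by rewrite (i5E 6%N) // s6.
rewrite -(i5E 4%N) // t6 -{1 2}r5E.
clear -c5 i10; rewrite /reject_if_zero /=.
case: (idx t5 5 == idx t5 6)%N; last by split; rewrite ?orbF.
have set4 : let s' := set_idx t5 4 1 in consistent s' /\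
    forall y, (10 <= y)%N -> idx s' y = idx s y.
  split; first by case: c5 => -[? ? ?] [? ? ?]; split; split.
  by move=> y y10 /=; rewrite ifF ?i10 //; lia.
case: set4 => c4 j10.
case: (reg t5 23 == reg t5 22) => /=; case: (idx t5 13 == idx t5 10) => //=;
  case: (reg t5 24 == reg t5 22) => //=.
all: split; rewrite ?orbT ?orbF //.
by move=> y /j10 /=; case: eqP.
Qed.

(** The search at depth [j]: the first [j] addresses are read off the loop counters, the other
    [11 - j] points are free. *)
Definition extends j (e : nat -> nat) :=
  exists2 b : seq 'I_n, size b = (11 - j)%N &
    degenerate_at ([seq e y | y <- iota 10 j] ++ [seq (2 * i)%N | i : 'I_n <- b]).

(** Contract of the program inside the [j] outer loops: their counters survive, and the flag in
    register 4 accumulates the degeneracies met below the current prefix. *)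
Definition checker j (T : nat) (c : program) := forall s, consistent s ->
  exists t s', [/\ exec c s t s', (t <= T)%N, consistent s',
    forall y, (10 <= y < 10 + j)%N -> idx s' y = idx s y &
    idx s' 4%N != 0%N <-> idx s 4%N != 0%N \/ extends j (idx s)].

Lemma checker_check_tuple : checker 11 (cost check_tuple) check_tuple.
Proof.
move=> s cs; have [t le_t et] := exec_sem s straight_check_tuple.
exists t, (sem check_tuple s); have [cs' iE fE] := sem_check_tuple cs.
split=> //; first by move=> y /andP[y10 _]; exact: iE.
rewrite fE; split=> [/orP[->|d]|[->|[b /size0nil -> d]]] //.
- by left.
- by right; exists [::]; rewrite ?cats0.
- by move: d; rewrite cats0 => ->; rewrite orbT.
Qed.

(** Each of the [n] rounds costs the body, one increment and one test; initialization and the final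
    failing test add 2. *)
Lemma checker_loop j T c : (j < 11)%N -> checker j.+1 T c ->
  checker j (n * (T + 2) + 2) (loop j c).
Proof.
move=> j11 Hc.
pose with_point s k : nat -> nat := [eta idx s with (10 + j)%N |-> (2 * k)%N].
have while_ r : forall s k, consistent s -> idx s (10 + j)%N = (2 * k)%N ->
    (k + r = n)%N ->
  exists t s', [/\ exec (While (ILt (10 + j) 0)
        (Seq c (Instr (IAdd (10 + j) (10 + j) 2)))) s t s',
      (t <= r * (T + 2) + 1)%N, consistent s',
      forall y, (10 <= y < 10 + j)%N -> idx s' y = idx s y &
      idx s' 4%N != 0%N <-> idx s 4%N != 0%N \/
        exists2 k', (k <= k' < n)%N & extends j.+1 (with_point s k')].
  elim: r => [|r IH] s k cs sj kr; have [[s0 _ s2] _] := cs.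
    exists 1%N, s; split=> //.
      by apply: exec_while_false; rewrite /= sj s0; lia.
    by split=> [|[|[k']]]; [left|by []|lia].
  have [t1 [s1 [e1 l1 c1 i1 f1]]] := Hc s cs.
  pose s1' := set_idx s1 (10 + j) (idx s1 (10 + j)%N + idx s1 2%N)%N.
  have c1' : consistent s1'.
    by case: c1 => -[? ? ?] [? ? ?]; split; split.
  have s1j : idx s1' (10 + j)%N = (2 * k.+1)%N.
    rewrite /s1' /= eqxx i1; last by lia.
    by case: c1 => -[_ _ ->] _; rewrite sj; lia.
  have [|t2 [s2' [e2 l2 c2 i2 f2]]] := IH s1' k.+1 c1' s1j; first by lia.
  exists (t1 + 1 + t2).+1, s2'; split=> //.
  - apply: exec_while_true e2; first by rewrite /= sj s0; lia.
    by apply: exec_seq e1 _; exact: exec_instr.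
  - by lia.
  - by move=> y hy; rewrite i2 // /s1' /= ifF ?i1 //; lia.
  (* [extends j.+1] reads only the counters 10 to [10 + j]: the outer ones are unchanged and the
     last is overridden by [with_point]. *)
  have ext k' : extends j.+1 (with_point s1' k') <-> extends j.+1 (with_point s k').
    have E : [seq with_point s1' k' y | y <- iota 10 j.+1] =
             [seq with_point s k' y | y <- iota 10 j.+1].
      apply/eq_in_map => y; rewrite mem_iota => hy; rewrite /with_point /=.
      by case: ifP => // yj; rewrite yj i1 //; lia.
    by rewrite /extends E.
  have extk : extends j.+1 (idx s) <-> extends j.+1 (with_point s k).
    have E : [seq with_point s k y | y <- iota 10 j.+1] =
             [seq idx s y | y <- iota 10 j.+1].
      by apply: eq_map => y; rewrite /with_point /=; case: eqP => // ->.
    by rewrite /extends E.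
  rewrite f2; have -> : (idx s1' 4%N != 0%N) = (idx s1 4%N != 0%N) by [].
  rewrite f1 extk; split.
    case=> [[|H]|[k' hk' /ext H]]; first by left.
      by right; exists k => //; lia.
    by right; exists k' => //; lia.
  case=> [|[k' hk' H]]; first by left; left.
  have [kk'|kk'] := eqVneq k' k; first by left; right; rewrite -kk'.
  by right; exists k'; [lia|apply/ext].
move=> s cs; have cs' : consistent (set_idx s (10 + j) 0).
  by case: cs => -[? ? ?] [? ? ?]; split; split.
have [||t [s' [e l' c' i f]]] := while_ n _ 0%N cs'; rewrite /= ?eqxx //.
exists (1 + t)%N, s'; split=> //.
- by apply: exec_seq e; exact: exec_instr.
- by lia.
- by move=> y hy; rewrite i //= ifF //; lia.
apply: (iff_trans f).
suff -> : (exists2 k', (0 <= k' < n)%N &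
     extends j.+1 (with_point (set_idx s (10 + j) 0) k')) <-> extends j (idx s) by [].
have E k : [seq with_point (set_idx s (10 + j) 0) k y | y <- iota 10 j.+1] =
           rcons [seq idx s y | y <- iota 10 j] (2 * k)%N.
  rewrite -[in iota _ j.+1](addn1 j) iotaD map_cat cats1.
  rewrite {2}/with_point /= eqxx; congr rcons.
  apply/eq_in_map => y; rewrite mem_iota => hy.
  by rewrite /with_point /= !ifF //; lia.
split.
  move=> [k kn [b sb]]; rewrite E cat_rcons => H.
  by exists (Ordinal kn :: b) => //=; rewrite sb; lia.
move=> [[|k b] /= sb H]; first by lia.
by exists k; rewrite ?ltn_ord //; exists b; [lia|rewrite E cat_rcons].
Qed.

(** Since [0 < n], one level turns a bound [T] into [n * (T + 2) + 2 <= n * (T + 4)]. *)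
Lemma checker_nest j T c : (0 < n)%N -> (j <= 11)%N -> checker j T c ->
  checker 0 ((T + 4 * j) * n ^ j) (nest j c).
Proof.
move=> n0; elim: j T c => [|j IH] T c jle Hc /=.
  by rewrite muln0 addn0 expn0 muln1.
move=> s cs; have [t [s' [e l' c' i f]]] := IH _ _ (ltnW jle) (checker_loop jle Hc) s cs.
exists t, s'; split=> //; apply: leq_trans l' _.
by rewrite expnS mulnA leq_mul2r; apply/orP; right; nia.
Qed.

(** The 48 is [4 * 11] for the eleven loops plus 4 for two initializations, the final test and the
    final assignment. At depth 0 no counter is read, whence the dummy environment. *)
Lemma decide_Omega_correct : (0 < n)%N ->
  decides_in decide_Omega l ((cost check_tuple + 48) * n ^ 11)
    (~ extends 0 (fun=> 0%N)).
Proof.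
move=> n0; pose s := set_idx (set_idx (initial l) 1 1) 2 2.
have cs : consistent s by split; split=> //=; rewrite size_l.
have [t [s' [e l' c' i f]]] := checker_nest n0 (leqnn 11) checker_check_tuple cs.
have n11 : (0 < n ^ 11)%N by rewrite expn_gt0 n0.
have f' : idx s' 4%N != 0%N <-> extends 0 (fun=> 0%N) by rewrite f /=; intuition.
exists (1 + (1 + (t + 2)))%N.
exists (set_idx s' 0 (idx s' 4%N == 0%N)); split.
- apply: exec_seq; first exact: exec_instr.
  apply: exec_seq; first exact: exec_instr.
  apply: exec_seq e _; apply: exec_if; rewrite /=.
  by have [[_ _ _] [-> _ _]] := c'; case: eqP => _; apply: exec_instr.
- move: (cost check_tuple) (n ^ 11)%N n11 l' => c N n11.
  by rewrite !mulnDl; lia.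
- rewrite /accepts /=; case: eqP f' => [_|_] f' /=.
    by split=> // _ /f'.
  by split=> // H; case: H; apply/f'.
Qed.

End Deciding.

(** * Rigid motions from equal distances *)

Section Congruence.
Variable R : rcfType.

Lemma sqr_add_eq0 (x y : R) : x ^+ 2 + y ^+ 2 = 0 -> x = 0 /\ y = 0.
Proof.
move=> /eqP; rewrite paddr_eq0 ?sqr_ge0 // !sqrf_eq0.
by move=> /andP[/eqP-> /eqP->].
Qed.

(* Two families of plane vectors x i = (a i, b i) and y i = (c i, d i) with the
   same Gram matrix satisfy the same linear relations. *)
Lemma gram_isometry (I : Type) (a b c d : I -> R) :
  (forall i j, a i * a j + b i * b j = c i * c j + d i * d j) ->
  exists m00 m01 m10 m11 : R,
    [/\ m00 ^+ 2 + m10 ^+ 2 = 1, m01 ^+ 2 + m11 ^+ 2 = 1,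
        m00 * m01 + m10 * m11 = 0 &
        forall i, m00 * a i + m01 * b i = c i /\ m10 * a i + m11 * b i = d i].
Proof.
move=> G.
have [[i [j D0]]|col] := pselect (exists i j, a i * b j - a j * b i != 0).
  set D := _ - _ in D0.
  have D2 : D ^+ 2 != 0 by rewrite expf_neq0.
  (* Cramer's rule for the linear map sending [x i] and [x j] to [y i] and [y j]. *)
  exists ((c i * b j - c j * b i) / D), ((c j * a i - c i * a j) / D).
  exists ((d i * b j - d j * b i) / D), ((d j * a i - d i * a j) / D).
  have Gii := G i i; have Gij := G i j; have Gjj := G j j.
  split.
  - apply: (mulIf D2); rewrite !expr_div_n mulrDl !divfK // mul1r.
    transitivity ((c i * c i + d i * d i) * b j ^+ 2 
       - 2 * (c i * c j + d i * d j) * b i * b j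
       + (c j * c j + d j * d j) * b i ^+ 2); first by ring.
    by rewrite -Gii -Gij -Gjj /D; ring.
  - apply: (mulIf D2); rewrite !expr_div_n mulrDl !divfK // mul1r.
    transitivity ((c i * c i + d i * d i) * a j ^+ 2 
       - 2 * (c i * c j + d i * d j) * a i * a j
       + (c j * c j + d j * d j) * a i ^+ 2); first by ring.
    by rewrite -Gii -Gij -Gjj /D; ring.
  - apply: (mulIf D2); rewrite mul0r !mulf_div -expr2 mulrDl !divfK //.
    transitivity ((c i * c j + d i * d j) * (a i * b j + a j * b i)
       - (c i * c i + d i * d i) * a j * b j
       - (c j * c j + d j * d j) * a i * b i); first by ring.
    by rewrite -Gii -Gij -Gjj; ring.
  move=> k.
  pose al := (a k * b j - a j * b k) / D; pose be := (a i * b k - a k * b i) / D.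
  have ak : a k = al * a i + be * a j by rewrite /al /be /D; field.
  have bk : b k = al * b i + be * b j by rewrite /al /be /D; field.
  (* As the Gram matrices agree, this is also the squared norm of [x k] minus its expansion in [x i]
     and [x j], which is zero. *)
  have : (c k - (al * c i + be * c j)) ^+ 2 + (d k - (al * d i + be * d j)) ^+ 2 = 0.
    transitivity ((c k * c k + d k * d k) - 2 * al * (c i * c k + d i * d k)
      - 2 * be * (c j * c k + d j * d k) + al ^+ 2 * (c i * c i + d i * d i)
      + 2 * al * be * (c i * c j + d i * d j) + be ^+ 2 * (c j * c j + d j * d j)).
      by ring.
    by rewrite -!G ak bk; ring.
  move=> /sqr_add_eq0[/subr0_eq-> /subr0_eq->].
  by split; rewrite /al /be; field.
have {}col i j : a i * b j = a j * b i.
  by apply/eqP; rewrite -subr_eq0; apply: contrapT => /negP ne; apply: col; exists i, j.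
have [[i v0]|v0] := pselect (exists i, a i ^+ 2 + b i ^+ 2 != 0); last first.
  exists 1, 0, 0, 1; rewrite expr1n expr0n /= !(addr0, add0r, mulr0, mul0r).
  split=> // i.
  have n0 : a i ^+ 2 + b i ^+ 2 = 0.
    by apply/eqP; apply: contrapT => /negP ne; apply: v0; exists i.
  have [-> ->] := sqr_add_eq0 n0.
  have [-> ->] : c i = 0 /\ d i = 0 by apply: sqr_add_eq0; rewrite !expr2 -G -!expr2.
  by rewrite !(addr0, add0r, mulr0, mul0r).
set V := _ + _ in v0; have V2 : V ^+ 2 != 0 by rewrite expf_neq0.
have VE : c i ^+ 2 + d i ^+ 2 = V by rewrite /V !expr2 G.
(* All vectors are now parallel to [x i], and a rotation suffices: its cosine and sine are the
   quotient of [y i] by [x i] as complex numbers. *)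
pose m := (a i * c i + b i * d i) / V; pose k := (a i * d i - b i * c i) / V.
have mk : m ^+ 2 + k ^+ 2 = 1.
  apply: (mulIf V2); rewrite !expr_div_n mulrDl !divfK // mul1r.
  transitivity (V * (c i ^+ 2 + d i ^+ 2)); first by rewrite /V; ring.
  by rewrite VE expr2.
exists m, (- k), k, m; split=> //; [by rewrite sqrrN addrC|by ring|].
move=> l; pose t := (a i * a l + b i * b l) / V.
have al : a l = t * a i.
  rewrite /t mulrAC; apply: (mulIf v0); rewrite divfK // /V.
  transitivity (a i ^+ 2 * a l + b i * (a i * b l)); last by ring.
  by rewrite col; ring.
have bl : b l = t * b i.
  rewrite /t mulrAC; apply: (mulIf v0); rewrite divfK // /V.
  transitivity (a i * (a l * b i) + b i ^+ 2 * b l); last by ring.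
  by rewrite -col; ring.
have : (c l - t * c i) ^+ 2 + (d l - t * d i) ^+ 2 = 0.
  transitivity ((c l * c l + d l * d l) - 2 * t * (c i * c l + d i * d l)
    + t ^+ 2 * (c i * c i + d i * d i)); first by ring.
  by rewrite -!G al bl; ring.
move=> /sqr_add_eq0[/subr0_eq-> /subr0_eq->].
by rewrite al bl /m /k /V; split; field.
Qed.

(** With point 0 as origin, polarization recovers the inner products from the distances, and
    [gram_isometry] gives the matrix. *)
Lemma congruent_rigid n (p q : 'M[R]_(2, n)) :
  (forall i j, sqd p i j = sqd q i j) ->
  exists (M : 'M[R]_2) (T : 'cV[R]_2),
    M^T *m M = 1%:M /\ forall i, M *m col i p + T = col i q.
Proof.
case: n p q => [|n] p q Hd.
  by exists 1%:M, 0; split; [rewrite trmx1 mulmx1|case].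
pose x (r : 'M[R]_(2, n.+1)) k i := r k i - r k 0.
have [|m00 [m01 [m10 [m11 [h0 h1 h01 hM]]]]] :=
    @gram_isometry 'I_n.+1 (x p 0) (x p 1) (x q 0) (x q 1).
  move=> i j; have := Hd i j; have := Hd i 0; have := Hd j 0.
  rewrite /sqd /x => e1 e2 e3.
  have two0 : (2 : R) != 0 by rewrite pnatr_eq0.
  apply: (mulfI two0).
  transitivity ((p 0 j - p 0 0) ^+ 2 + (p 1 j - p 1 0) ^+ 2 +
     ((p 0 i - p 0 0) ^+ 2 + (p 1 i - p 1 0) ^+ 2) -
     ((p 0 i - p 0 j) ^+ 2 + (p 1 i - p 1 j) ^+ 2)); first by ring.
  by rewrite e1 e2 e3; ring.
pose M : 'M[R]_2 := \matrix_(k, l)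
  if k == 0 then (if l == 0 then m00 else m01) else (if l == 0 then m10 else m11).
exists M, (col 0 q - M *m col 0 p); split.
  apply/matrixP => k l; rewrite !mxE !big_ord_recl big_ord0 !mxE /=.
  case: k => -[|[|//]] hk; case: l => -[|[|//]] hl; rewrite /= addr0.
  - by rewrite -[RHS]h0; ring.
  - by rewrite -[RHS]h01; ring.
  - by rewrite -[RHS]h01; ring.
  - by rewrite -[RHS]h1; ring.
move=> i; rewrite addrCA -mulmxBr; apply/matrixP => k l; rewrite !mxE.
rewrite !big_ord_recl big_ord0 !mxE /= addr0.
have [e0 e1] := hM i; rewrite /x in e0 e1.
have l1 : lift ord0 ord0 = 1 :> 'I_2 by apply/val_inj.
rewrite !l1; case: k => -[|[|//]] hk.
- have -> : Ordinal hk = 0 by apply/val_inj.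
  by rewrite /= e0; ring.
- have -> : Ordinal hk = 1 by apply/val_inj.
  by rewrite /= e1; ring.
Qed.

End Congruence.

(** * Bijections of edges and permutations of points *)

Section Relabelling.

(** Values may repeat, so the bijection is a choice: it comes from a permutation of positions
    matching the two lists. *)
Lemma perm_eq_map_bij (T U : eqType) (f g : T -> U) (s : seq T) :
    uniq s -> perm_eq [seq f x | x <- s] [seq g x | x <- s] ->
  exists psi phi : T -> T, forall x, x \in s ->
    [/\ psi x \in s, phi x \in s, phi (psi x) = x, psi (phi x) = x &
        f x = g (psi x)].
Proof.
case: s => [|x0 s0]; first by exists id, id.
set s := x0 :: s0 => us /(perm_iotaP (f x0))[Is pIs eIs].
have sIs : size Is = size s by rewrite (perm_size pIs) size_iota size_map.
have uIs : uniq Is by rewrite (perm_uniq pIs) iota_uniq.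
have memIs i : (i \in Is) = (i < size s)%N.
  by rewrite (perm_mem pIs) mem_iota size_map.
exists (fun x => nth x0 s (nth 0%N Is (index x s))).
exists (fun x => nth x0 s (index (index x s) Is)).
move=> x xs; have ixs : (index x s < size s)%N by rewrite index_mem.
have Ixs : (nth 0%N Is (index x s) < size s)%N by rewrite -memIs mem_nth ?sIs.
have iIs : (index (index x s) Is < size s)%N by rewrite -sIs index_mem memIs.
rewrite !mem_nth // !index_uniq ?sIs // !nth_index ?memIs //; split=> //.
rewrite -(nth_map _ (f x0)) // -[RHS](nth_map 0%N (f x0) (nth (f x0) _)) ?sIs //.
by rewrite -eIs (nth_map x0) // nth_index.
Qed.

Variable T : finType.
Implicit Types (A B : {set T}) (psi : {set T} -> {set T}).

Lemma card2_eq_pair A u v : #|A| = 2%N -> u \in A -> v \in A -> u != v ->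
  A = [set u; v].
Proof.
move=> A2 uA vA uv; apply/esym/eqP; rewrite eqEcard A2 cards2 uv andbT.
by rewrite finset.subUset !finset.sub1set uA vA.
Qed.

Variable psi : {set T} -> {set T}.
Hypothesis psi2 : forall A, #|A| = 2%N -> #|psi A| = 2%N.
Hypothesis psi_inj : forall A B, #|A| = 2%N -> #|B| = 2%N -> psi A = psi B -> A = B.

(** With three points the edges are the complements of the points, so an injection of edges is one
    of points; with fewer there is at most one edge and the identity works. *)
Lemma edge_map_small : (#|T| <= 3)%N ->
  exists s : {perm T}, forall u v, u != v -> psi [set u; v] = [set s u; s v].
Proof.
rewrite leq_eqVlt => /orP[/eqP T3|T2]; last first.
  exists 1%g => u v uv; rewrite !perm1.
  have full A : #|A| = 2%N -> A = finset.setT.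
    move=> A2; apply/eqP; rewrite eqEcard finset.subsetT A2 cardsT.
    by rewrite -ltnS.
  have uv2 : #|[set u; v]| = 2%N by rewrite cards2 uv.
  by rewrite (full _ (psi2 uv2)) -(full _ uv2).
have c2 (u : T) : #|~: [set u]| = 2%N by rewrite cardsC1 T3.
have /choice[s sE] : forall u, exists z, psi (~: [set u]) = ~: [set z].
  move=> u; have : #|~: psi (~: [set u])| == 1%N.
    by have := cardsC (psi (~: [set u])); rewrite psi2 // T3 => /eqP.
  by move=> /cards1P[z zE]; exists z; rewrite -zE finset.setCK.
have s_inj : injective s.
  move=> u v suv; apply/finset.set1P.
  have : ~: [set u] = ~: [set v] by apply: psi_inj; rewrite ?sE ?suv.
  by move=> /(congr1 (@finset.setC T)); rewrite !finset.setCK => <-; rewrite finset.set11.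
exists (perm s_inj) => u v uv; rewrite !permE.
have : #|~: [set u; v]| == 1%N.
  by have := cardsC [set u; v]; rewrite cards2 uv T3 => /eqP.
move=> /cards1P[w wE].
have wuv : w \notin [set u; v] by rewrite -finset.in_setC wE finset.set11.
have -> : [set u; v] = ~: [set w] by rewrite -wE finset.setCK.
have := psi2 (c2 w); rewrite sE => cw.
move: wuv; rewrite !inE negb_or => /andP[wu wv].
by apply: card2_eq_pair; rewrite ?inE ?(inj_eq s_inj) // 1?eq_sym.
Qed.

(** The images of all edges at [u] meet in one point, taken as [s u]: two distinct edges share at
    most one point, so the point common to three images lies on every other. *)
Lemma edge_map_large : (4 <= #|T|)%N ->
    (forall u v w x, uniq [:: u; v; w; x] ->
       exists z, [/\ z \in psi [set u; v], z \in psi [set u; w] &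
                     z \in psi [set u; x]]) ->
  exists s : {perm T}, forall u v, u != v -> psi [set u; v] = [set s u; s v].
Proof.
move=> T4 star.
have fresh (l : seq T) : (size l < 4)%N -> exists z, z \notin l.
  move=> l4; apply: contrapT => H.
  have : (#|T| <= size l)%N.
    rewrite cardE; apply: uniq_leq_size; first exact: enum_uniq.
    by move=> z _; apply: contrapT => /negP zl; apply: H; exists z.
  by lia.
have edge2 (u v : T) : u != v -> #|[set u; v]| = 2%N by move=> uv; rewrite cards2 uv.
have /choice[s sP] : forall u, exists z, forall v, u != v -> z \in psi [set u; v].
  move=> u; have [//|v vu] := fresh [:: u].
  have [//|w wuv] := fresh [:: u; v]; have [//|x xuvw] := fresh [:: u; v; w].
  move: vu wuv xuvw; rewrite !inE !negb_or => vu /andP[wu wv] /and3P[xu xv xw].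
  have [|z [zv zw zx]] := star u v w x.
    by rewrite -rev_uniq /rev /= !inE !negb_or vu wu xu wv xv xw.
  exists z => y uy; have [->//|yv] := eqVneq y v; have [->//|yw] := eqVneq y w.
  have [|z' [zv' zw' zy']] := star u v w y.
    by rewrite -rev_uniq /rev /= !inE !negb_or vu wu wv yv yw eq_sym uy.
  have [->//|zz'] := eqVneq z z'.
  have uv : u != v by rewrite eq_sym.
  have uw : u != w by rewrite eq_sym.
  have : [set u; v] = [set u; w].
    apply: psi_inj; rewrite ?edge2 //.
    rewrite (card2_eq_pair (psi2 (edge2 _ _ uv)) zv zv' zz').
    by rewrite (card2_eq_pair (psi2 (edge2 _ _ uw)) zw zw' zz').
  by move=> /finset.setP/(_ w); rewrite !inE eqxx orbT (negPf wu) (negPf wv).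
pose F (u : T) := [set A : {set T} | #|A| == 2%N & u \in A].
have cF u : #|F u| = #|T|.-1.
  rewrite -(cardsC1 u) -(card_in_imset (f := fun v => [set u; v])).
    apply: eq_card => A; rewrite !inE; apply/andP/imsetP => [[/cards2P[a [b [ab ->]]]]|].
      rewrite !inE => /orP[/eqP ua|/eqP ub].
        by exists b; rewrite ?inE ua // eq_sym.
      by exists a; rewrite ?inE ub // finset.setUC.
    by move=> [v]; rewrite !inE => vu ->; rewrite cards2 [u == _]eq_sym vu set21.
  move=> v w; rewrite !inE => vu wu /setP/(_ v).
  by rewrite !inE eqxx orbT (negPf vu) => /esym/eqP.
have s_inj : injective s.
  move=> u v suv; apply/eqP; apply: contraT => uv.
  have [//|x] := fresh [:: u; v]; rewrite !inE negb_or => /andP[xu xv].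
  have vx : [set v; x] \notin F u.
    by rewrite !inE negb_and negb_or [u == x]eq_sym uv xu orbT.
  (* If [s u = s v], the edges at [u] together with [[set v; x]] would inject into the edges at
     [s u], one too few. *)
  have sub : psi @: ([set v; x] |: F u) \subset F (s u).
    apply/fintype.subsetP => _ /imsetP[A hA ->]; move: hA; rewrite !inE.
    move=> /orP[/eqP->|/andP[/cards2P[a [b [ab ->]]]]].
      by rewrite psi2 ?edge2 1?eq_sym // suv sP 1?eq_sym.
    rewrite psi2 ?edge2 //= !inE => /orP[/eqP->|/eqP->]; first exact: sP.
    by rewrite finset.setUC sP // eq_sym.
  have := subset_leq_card sub; rewrite card_in_imset ?cardsU1 ?vx ?cF; first by lia.
  have card2 A : A \in [set v; x] |: F u -> #|A| = 2%N.
    by rewrite !inE => /orP[/eqP->|/andP[/eqP->]//]; rewrite edge2 1?eq_sym.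
  by move=> A B /card2 A2 /card2 B2; exact: psi_inj.
exists (perm s_inj) => u v uv; rewrite !permE.
apply: card2_eq_pair; rewrite ?psi2 ?edge2 ?sP ?(inj_eq s_inj) //.
by rewrite finset.setUC sP // eq_sym.
Qed.

End Relabelling.

(** * Reconstruction of the points of [Omega] *)

Section Reconstruction.
Variable R : realType.
Variable n : nat.
Implicit Types (p q : 'M[R]_(2, n)) (A B F : {set 'I_n}).

(* Twice the squared length of the edge A; the sum over ordered pairs spares
   the choice of an orientation. *)
Definition sqlen p A : R := \sum_(i in A) \sum_(j in A) sqd p i j.

Lemma sqlenE p i j : i != j -> sqlen p [set i; j] = 2 * sqd p i j.
Proof.
move=> ij; have sum2 (f : 'I_n -> R) : \sum_(k in [set i; j]) f k = f i + f j.
  by rewrite big_setU1 ?inE // big_set1.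
have sqd0 k : sqd p k k = 0 by rewrite /sqd; ring.
by rewrite /sqlen sum2 !sum2 (sqdC p j i) !sqd0; ring.
Qed.

Lemma edist_sqd p i j : Defs.edist (col i p) (col j p) ^+ 2 = sqd p i j.
Proof.
rewrite sqr_sqrtr; last by apply: sumr_ge0 => k _; exact: sqr_ge0.
rewrite !big_ord_recl big_ord0 addr0 !mxE /sqd.
by have -> : lift ord0 ord0 = 1 :> 'I_2 by apply/val_inj.
Qed.

Lemma same_distribution_bij p q : same_distribution p q ->
  exists psi phi : {set 'I_n} -> {set 'I_n}, forall A, #|A| = 2%N ->
    [/\ #|psi A| = 2%N, #|phi A| = 2%N, phi (psi A) = A, psi (phi A) = A &
        sqlen p A = sqlen q (psi A)].
Proof.
pose L := enum [pred ij : 'I_n * 'I_n | (ij.1 < ij.2)%N].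
pose E := [seq edge ij | ij <- L].
have LP ij : ij \in L = (ij.1 < ij.2)%N by rewrite mem_enum.
have uE : uniq E.
  rewrite map_inj_in_uniq ?enum_uniq // => -[i j] [k l]; rewrite !LP /= => ij kl.
  move=> /eqP; rewrite edge_eq /= => /orP[/andP[/eqP-> /eqP->]//|].
  by move=> /andP[/eqP ik /eqP jl]; move: ij; rewrite ik jl ltnNge ltnW.
have EP A : (A \in E) = (#|A| == 2%N).
  apply/mapP/cards2P => [[[i j]]|[i [j [ij ->]]]].
    by rewrite LP /= => ij ->; exists i, j; rewrite neq_ltn ij.
  move: ij; rewrite neq_ltn => /orP[ij|ji].
    by exists (i, j); rewrite ?LP.
  by exists (j, i); rewrite ?LP // /edge /= finset.setUC.
have lenE r : [seq sqlen r A | A <- E] = [seq 2 * x ^+ 2 | x <- distances r].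
  rewrite /E /distances /image_mem -!map_comp; apply/eq_in_map => -[i j].
  by rewrite LP /= => ij; rewrite edist_sqd sqlenE // neq_ltn ij.
move=> /(perm_map (fun x => 2 * x ^+ 2)); rewrite -!lenE.
move=> /(perm_eq_map_bij uE)[psi [phi H]]; exists psi, phi => A /eqP.
by rewrite -EP => /H[]; rewrite !EP => /eqP-> /eqP->.
Qed.

Lemma sqlen_cm_planar p a b c d : uniq [:: a; b; c; d] ->
  let D i j := sqlen p [set i; j] in
  cm (D a b) (D c d) (D a c) (D b d) (D a d) (D b c) = 0.
Proof.
rewrite /= !inE !negb_or => /and4P[/and3P[ab ac ad] /andP[bc bd] cd _].
rewrite !sqlenE //; have := cm_planar p a b c d; rewrite /cm => H.
(* [cm] is homogeneous of degree 3 and [sqlen] doubles, whence the factor 8. *)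
transitivity (8 * (0 : R)); last by rewrite mulr0.
by rewrite -H; ring.
Qed.

Lemma K4_edges_uniq (a b c d : 'I_n) : uniq [:: a; b; c; d] ->
  let es := [:: (a, b); (c, d); (a, c); (b, d); (a, d); (b, c)] in
  uniq [seq edge e | e <- es].
Proof.
rewrite /= !inE !negb_or => /and4P[/and3P[ab ac ad] /andP[bc bd] cd _].
have ne (i j : 'I_n) : i != j -> ((i == j) = false) * ((j == i) = false).
  by rewrite [j == i]eq_sym => /negPf.
by rewrite !edge_eq /= !(ne _ _ ab, ne _ _ ac, ne _ _ ad, ne _ _ bc, ne _ _ bd, ne _ _ cd)
  /= ?andbF.
Qed.

Lemma perm_star_order (T : eqType) (x1 x2 x3 x4 x5 x6 : T) :
  perm_eq [:: x1; x2; x3; x4; x5; x6] [:: x1; x6; x2; x5; x4; x3].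
Proof. by apply/seq.permP => P /=; lia. Qed.

Section NonDegenerate.
Variable p : 'M[R]_(2, n).
Hypothesis Op : Omega p.

Lemma Omega_cm (e1 e2 e3 e4 e5 e6 : 'I_n * 'I_n) :
    let E := [:: e1; e2; e3; e4; e5; e6] in
    all (fun e => e.1 != e.2) E -> uniq [seq edge e | e <- E] -> e1.1 = e2.1 ->
  let D e := sqlen p (edge e) in
  cm (D e1) (D e2) (D e3) (D e4) (D e5) (D e6) != 0 /\
  (e3.1 = e1.1 -> cm (D e1) (D e6) (D e2) (D e5) (D e4) (D e3) != 0).
Proof.
move=> E nl uE e12 D.
(* The common endpoint takes index 0, the other ends of [e1] and [e2] indices 1 and 2, the ends of
   [e3] to [e6] indices 3 to 10. *)
have := Op (e1.1, [tuple e1.1; e1.2; e2.2; e3.1; e3.2; e4.1; e4.2; e5.1; e5.2;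
  e6.1; e6.2]).
set x := nth _ _; rewrite /degenerate negb_and has_clash.
have -> : all (fun e => x e.1 != x e.2) edges &&
    uniq [seq edge (x e.1, x e.2) | e <- edges].
  apply/andP; split; first by move: nl; rewrite /= -e12.
  by move: uE; rewrite /edge /= -e12.
rewrite eval_adjacentE eval_starE negb_or /= negb_and /x /=.
move: nl; rewrite /= => /and5P[n1 n2 n3 n4 /and3P[n5 n6 _]].
rewrite /D /edge !sqlenE // -e12 => /andP[H1 H2]; split.
  apply: contraNneq H1 => H; apply/eqP; apply: (mulfI (x := 8)).
    by rewrite pnatr_eq0.
  by rewrite mulr0 -H /cm; ring.
move=> e31; move: H2; rewrite e31 eqxx /= => H2.
apply: contraNneq H2 => H; apply/eqP; apply: (mulfI (x := 8)).
  by rewrite pnatr_eq0.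
by rewrite mulr0 -H /cm; ring.
Qed.

Lemma Omega_sqlen u v w F3 F4 F5 F6 :
    let E := [:: [set u; v]; [set u; w]; F3; F4; F5; F6] in
    all (fun F : {set 'I_n} => #|F| == 2%N) E -> uniq E ->
  let D := sqlen p in
  cm (D [set u; v]) (D [set u; w]) (D F3) (D F4) (D F5) (D F6) != 0 /\
  (u \in F3 ->
   cm (D [set u; v]) (D F6) (D [set u; w]) (D F5) (D F4) (D F3) != 0).
Proof.
rewrite /= !cards2 => /and5P[uv uw c3 c4 /and3P[c5 c6 _]] uE.
have {}uv : u != v by case: (u != v) uv.
have {}uw : u != w by case: (u != w) uw.
(* If [u] lies on [F3] it must be named first, since the condition on [starE] compares the points 0
   and 3. *)
have e3 : exists a b, [/\ a != b, F3 = [set a; b] & u \in F3 -> a = u].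
  have /cards2P[a [b [ab F3E]]] := c3.
  have [ub|ub] := eqVneq u b.
    by exists b, a; rewrite eq_sym ub F3E finset.setUC.
  exists a, b; split=> //; rewrite F3E !inE (negPf ub) orbF.
  by move=> /eqP.
have [a [b [ab F3E ua]]] := e3; have /cards2P[a4 [b4 [ab4 F4E]]] := c4.
have /cards2P[a5 [b5 [ab5 F5E]]] := c5; have /cards2P[a6 [b6 [ab6 F6E]]] := c6.
have [] := @Omega_cm (u, v) (u, w) (a, b) (a4, b4) (a5, b5) (a6, b6).
- by rewrite /= uv uw ab ab4 ab5 ab6.
- by move: uE; rewrite /= F3E F4E F5E F6E.
- by [].
by rewrite /edge /= -F3E -F4E -F5E -F6E => H1 H2; split=> // /ua.
Qed.

Variable q : 'M[R]_(2, n).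
Variables psi phi : {set 'I_n} -> {set 'I_n}.
Hypothesis bij : forall A, #|A| = 2%N ->
    [/\ #|psi A| = 2%N, #|phi A| = 2%N, phi (psi A) = A, psi (phi A) = A &
        sqlen p A = sqlen q (psi A)].

Lemma sqlen_phi A : #|A| = 2%N -> sqlen p (phi A) = sqlen q A.
Proof. by move=> /bij[_ phi2 _ psiK _]; have [_ _ _ _ ->] := bij phi2; rewrite psiK. Qed.

(** The relation holds for four points of [q]; as [psi] preserves lengths, it transfers to the
    preimages in [p]. *)
Lemma K4_preimage a b c d : uniq [:: a; b; c; d] ->
  let E := [:: phi [set a; b]; phi [set c; d]; phi [set a; c]; phi [set b; d];
               phi [set a; d]; phi [set b; c]] in
  [/\ all (fun F : {set 'I_n} => #|F| == 2%N) E, uniq E &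
      let D i j := sqlen p (phi [set i; j]) in
      cm (D a b) (D c d) (D a c) (D b d) (D a d) (D b c) = 0].
Proof.
move=> abcd; have cm0 := sqlen_cm_planar q abcd.
pose es := [:: (a, b); (c, d); (a, c); (b, d); (a, d); (b, c)].
have uE : uniq [seq edge e | e <- es] := K4_edges_uniq abcd.
move: abcd; rewrite [uniq _]/= !inE !negb_or.
move=> /and4P[/and3P[ab ac ad] /andP[bc bd] cd _] E.
have e2 (i j : 'I_n) : i != j -> #|[set i; j]| = 2%N by move=> ij; rewrite cards2 ij.
have phi2 (i j : 'I_n) : i != j -> #|phi [set i; j]| == 2%N.
  by move=> /e2/bij[_ /eqP].
split; [by rewrite /= !phi2| |by rewrite /= !sqlen_phi ?e2].
rewrite (_ : E = [seq phi A | A <- [seq edge e | e <- es]]) // map_inj_in_uniq // => A B.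
have /allP nl : all (fun e => e.1 != e.2) es by rewrite /= ab ac ad bc bd cd.
have EE C : C \in [seq edge e | e <- es] -> psi (phi C) = C.
  by move=> /mapP[e /nl ne ->]; have [] // := bij (A := edge e); rewrite cards2 ne.
by move=> /EE {2}<- /EE {2}<- ->.
Qed.

(** Disjoint images of two edges at [u] would be opposite edges of a K4, which [adjacentE] excludes;
    three pairwise meeting images without a common point would form a triangle, which [starE]
    excludes. *)
Lemma star_image (n4 : (4 <= n)%N) u v w x : uniq [:: u; v; w; x] ->
  exists z, [/\ z \in psi [set u; v], z \in psi [set u; w] & z \in psi [set u; x]].
Proof.
rewrite /= !inE !negb_or => /and4P[/and3P[uv uw ux] /andP[vw vx] wx _].
have e2 (i j : 'I_n) : i != j -> #|[set i; j]| = 2%N by move=> ij; rewrite cards2 ij.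
have adj v' w' : u != v' -> u != w' -> v' != w' ->
    exists2 z, z \in psi [set u; v'] & z \in psi [set u; w'].
  move=> uv' uw' vw'; apply: contrapT => dis.
  have [c1 _ k1 _ _] := bij (e2 _ _ uv'); have [c2 _ k2 _ _] := bij (e2 _ _ uw').
  have /cards2P[a [b [ab E1]]] := introT eqP c1.
  have /cards2P[c [d [cd E2]]] := introT eqP c2.
  have uabcd : uniq [:: a; b; c; d].
    rewrite /= !inE !negb_or ab cd /= andbT.
    have ne i j : i \in [set a; b] -> j \in [set c; d] -> i != j.
      move=> hi hj; apply/eqP => ij; apply: dis.
      by exists i; rewrite ?E1 ?E2 // ij.
    by rewrite !ne ?inE ?eqxx ?orbT.
  have [E2all Euniq cm0] := K4_preimage uabcd.
  have := @Omega_sqlen u v' w' (phi [set a; c]) (phi [set b; d])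
    (phi [set a; d]) (phi [set b; c]).
  by rewrite -k1 -k2 E1 E2 => /(_ E2all Euniq)[/eqP].
have [z1 z1v z1w] := adj v w uv uw vw.
have [z2 z2v z2x] := adj v x uv ux vx.
have [z3 z3w z3x] := adj w x uw ux wx.
have [?|z1x] := boolP (z1 \in psi [set u; x]); first by exists z1.
have [?|z2w] := boolP (z2 \in psi [set u; w]); first by exists z2.
have z12 : z1 != z2 by apply: contraNneq z1x => ->.
have z13 : z1 != z3 by apply: contraNneq z1x => ->.
have z23 : z2 != z3 by apply: contraNneq z2w => ->.
have [cv _ kv _ _] := bij (e2 _ _ uv); have [cw _ kw _ _] := bij (e2 _ _ uw).
have [cx _ kx _ _] := bij (e2 _ _ ux).
have Ev := card2_eq_pair cv z1v z2v z12; have Ew := card2_eq_pair cw z1w z3w z13.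
have Ex := card2_eq_pair cx z2x z3x z23.
(* A fourth point, available as [4 <= n], completes the triangle to a K4. *)
have [d] : exists d, d \notin [:: z1; z2; z3].
  apply: contrapT => H; have : (#|'I_n| <= 3)%N.
    rewrite cardE -[3%N]/(size [:: z1; z2; z3]).
    apply: uniq_leq_size; first exact: enum_uniq.
    by move=> z _; apply: contrapT => /negP zl; apply: H; exists z.
  by rewrite card_ord leqNgt n4.
rewrite !inE !negb_or => /and3P[d1 d2 d3].
have [|E2all Euniq cm0] := @K4_preimage z1 z2 z3 d.
  by rewrite /= !inE !negb_or z12 z13 z23 ![_ == d]eq_sym d1 d2 d3.
have := @Omega_sqlen u v w [set u; x] (phi [set z1; d]) (phi [set z2; d])
  (phi [set z3; d]).
set E := [:: [set u; v]; _; _; _; _; _] => H.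
have pE : perm_eq E [:: phi [set z1; z2]; phi [set z3; d]; phi [set z1; z3];
    phi [set z2; d]; phi [set z1; d]; phi [set z2; z3]].
  by rewrite -Ev -Ew -Ex kv kw kx; exact: perm_star_order.
have [||_ /(_ (set21 _ _)) /eqP[]] := H.
- by rewrite (perm_all _ pE).
- by rewrite (perm_uniq pE).
by rewrite -kv -kw -kx Ev Ew Ex.
Qed.

End NonDegenerate.

Lemma Omega_reconstructible p : Omega p -> reconstructible p.
Proof.
move=> Op q /same_distribution_bij[psi [phi bij]].
have psi2 A : #|A| = 2%N -> #|psi A| = 2%N by move=> /bij[].
have psi_inj A B : #|A| = 2%N -> #|B| = 2%N -> psi A = psi B -> A = B.
  by move=> /bij[_ _ kA _ _] /bij[_ _ kB _ _] AB; rewrite -kA AB.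
have [s sE] : exists s : {perm 'I_n},
    forall u v, u != v -> psi [set u; v] = [set s u; s v].
  have [n3|n4] := leqP #|'I_n| 3; first exact: edge_map_small.
  apply: edge_map_large => // u v w x; apply: star_image bij _ _ _ _ _ => //.
  by rewrite card_ord in n4.
have two0 : (2 : R) != 0 by rewrite pnatr_eq0.
(* Relabelling the points of [q] by [s] makes the labelled distances agree. *)
have [|M [T [oM MT]]] := @congruent_rigid R n p (col_perm s q).
  move=> i j; have [->|ij] := eqVneq i j; first by rewrite /sqd !subrr.
  apply: (mulfI two0); rewrite -sqlenE //.
  have [|_ _ _ _ ->] := bij [set i; j]; first by rewrite cards2 ij.
  by rewrite sE // sqlenE ?(inj_eq perm_inj) // /sqd !mxE.
exists M, T, s; split=> // i; rewrite MT.
by apply/matrixP => k l; rewrite !mxE.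
Qed.

Lemma size_coordinates p : size (coordinates p) = (2 * n)%N.
Proof. by rewrite size_allpairs !size_enum_ord mulnC. Qed.

Lemma nth_coordinates p (i : 'I_n) (k : bool) :
  nth 0 (coordinates p) (2 * i + k) = p (if k then 1 else 0) i.
Proof.
rewrite /coordinates; have -> : enum 'I_2 = [:: 0; 1].
  by apply: (inj_map val_inj); rewrite val_enum_ord.
have nthE (s : seq 'I_n) j i0 : (j < size s)%N ->
    nth 0 [seq p k i | i <- s, k <- [:: 0; 1]] (2 * j + k) =
    p (if k then 1 else 0) (nth i0 s j).
  elim: s j => //= i' s IH [|j] hj; first by case: (k).
  by rewrite mulnS -addnA add2n /= IH.
by rewrite (nthE _ _ i) ?size_enum_ord // nth_ord_enum.
Qed.

Lemma degenerate_at_coordinates p (u : 'I_n) (b : 11.-tuple 'I_n) :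
  degenerate_at (coordinates p) [seq (2 * i)%N | i : 'I_n <- b] =
  degenerate (coord_of p (nth u b)) (nth u b).
Proof.
set a := [seq _ | _ <- _].
have aE j : (j < 11)%N -> nth 0%N a j = (2 * nth u b j)%N.
  by move=> j11; rewrite (nth_map u) ?size_tuple.
rewrite /degenerate_at /degenerate.
have dbl i j : (i < 11)%N -> (j < 11)%N ->
    (nth 0%N a i == nth 0%N a j) = (nth u b i == nth u b j).
  by move=> i11 j11; rewrite !aE // eqn_pmul2l.
rewrite !dbl //; congr (~~ _ && (_ || _ && _)).
- by rewrite /= /clash /= !dbl.
- congr (_ == 0); apply: (@eq_eval_expr_lt _ 11) => // j k j11.
  by rewrite aE // nth_coordinates.
- congr (_ == 0); apply: (@eq_eval_expr_lt _ 11) => // j k j11.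
  by rewrite aE // nth_coordinates.
Qed.

Lemma extends_Omega p e : extends n (coordinates p) 0 e <-> ~ Omega p.
Proof.
split=> [[b /= sb H] Op|].
  have n0 : 'I_n by case: b sb {H}.
  have sb11 : size b == 11%N by rewrite sb.
  have dE := degenerate_at_coordinates p n0 (Tuple sb11).
  by apply: (negP (Op (n0, Tuple sb11))); rewrite /= -dE.
move=> /existsNP[[u b] /=] /negP; rewrite negbK -degenerate_at_coordinates => H.
by exists b; rewrite ?size_tuple.
Qed.

End Reconstruction.

Theorem corollary1p4 (R : realType) :
  exists Omega : forall n : nat, set 'M[R]_(2, n),
    (forall n : nat, (0 < n)%N ->
       [/\ open (Omega n), dense (Omega n) &
           forall p : 'M[R]_(2, n), Omega n p -> reconstructible p]) /\
    (exists (A : program) (C : nat), forall n : nat, (0 < n)%N ->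
       forall p : 'M[R]_(2, n),
         decides_in A (coordinates p) (C * n ^ 11)%N (Omega n p)).
Proof.
exists (@Omega R); split=> [n _|].
  have [oO dO] := Omega_open_dense R n; split=> // p.
  exact: Omega_reconstructible.
exists decide_Omega, (cost check_tuple + 48)%N => n n0 p.
have [t [s [e le_t acc]]] := decide_Omega_correct (size_coordinates p) n0.
exists t, s; split=> //; rewrite acc extends_Omega.
by split=> [/contrapT|Op].
Qed.
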